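(* For every $n\ge 1$ there exists a bijection $$\alpha:\mathfrak{S}_n(31245,32145,31254,32154)\to\mathfrak{S}_n(31425,32415,31524,32514)$$ such that for every $\pi$ in the domain, $$(\mathrm{Ides},\mathrm{Lrmax},\mathrm{Lrmin},\mathrm{Rlmax},\mathrm{Iar})(\pi)=(\mathrm{Ides},\mathrm{Lrmax},\mathrm{Lrmin},\mathrm{Rlmax},\mathrm{Iar})(\alpha(\pi)).$$
   Context: $\mathfrak{S}_n$ is the set of permutations of $[n]=\{1,\dots,n\}$, written as words $\pi=\pi_1\cdots\pi_n$. A permutation $\pi$ contains a pattern $P=p_1\cdots p_k$ (a permutation of $[k]$) if there are indices $i_1<\dots<i_k$ such that $\pi_{i_1}\cdots\pi_{i_k}$ is order-isomorphic to $P$; otherwise $\pi$ avoids $P$. $\mathfrak{S}_n(P_1,\dots,P_r)$ denotes the set of permutations in $\mathfrak{S}_n$ avoiding each of $P_1,\dots,P_r$. Statistics (set-valued): $\mathrm{Ides}(\pi)=\{i\in[n-1]:\pi^{-1}(i)>\pi^{-1}(i+1)\}$ (inverse descent set); $\mathrm{Lrmax}(\pi)$ = set of letters $\pi_i$ with $\pi_i>\pi_j$ for all $j<i$ (left-to-right maxima); $\mathrm{Lrmin}(\pi)$ = set of letters $\pi_i$ with $\pi_i<\pi_j$ for all $j<i$ (left-to-right minima); $\mathrm{Rlmax}(\pi)$ = set of letters $\pi_i$ with $\pi_i>\pi_j$ for all $j>i$ (right-to-left maxima); $\mathrm{Iar}(\pi)$ = set of letters in the initial ascending run of $\pi$, i.e.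 $\{\pi_1,\dots,\pi_m\}$ where $m$ is maximal with $\pi_1<\pi_2<\dots<\pi_m$. *)

(* Defs.v *)
From mathcomp Require Import all_boot all_fingroup.
Set Implicit Arguments. Unset Strict Implicit. Unset Printing Implicit Defensive.

(* Convention: a permutation of [n] = {1..n} is a {perm 'I_n}; position i and
   letter v (both in 1..n) are represented by the ordinals i-1 and v-1.
   pi_i is (pi (i-1)) + 1. Statistics are sets of letters, shifted by -1. *)

Definition contains (n : nat) (pi : {perm 'I_n}) (P : seq nat) : Prop :=
  exists f : 'I_(size P) -> 'I_n,
    (forall a b : 'I_(size P), (a < b)%N -> (f a < f b)%N) /\
    (forall a b : 'I_(size P),
        (pi (f a) < pi (f b))%N = (nth 0 P a < nth 0 P b)%N).

Definition avoids (n : nat) (pi : {perm 'I_n}) (P : seq nat) : Prop :=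
  ~ contains pi P.

Definition avoids_all (n : nat) (pi : {perm 'I_n}) (Ps : seq (seq nat)) : Prop :=
  forall P, P \in Ps -> avoids pi P.

(* Ides(pi) = { i in [n-1] : pi^{-1}(i) > pi^{-1}(i+1) }, shifted: ordinal j
   stands for letter j+1, so j is in Ides iff j+1 < n and
   pi^{-1}(j) > pi^{-1}(j+1) (0-based). *)
Definition Ides (n : nat) (pi : {perm 'I_n}) : {set 'I_n} :=
  [set j : 'I_n | [exists j' : 'I_n,
      (nat_of_ord j' == (nat_of_ord j).+1) && ((pi^-1)%g j' < (pi^-1)%g j)%N]].

Definition Lrmax (n : nat) (pi : {perm 'I_n}) : {set 'I_n} :=
  [set pi i | i : 'I_n & [forall j : 'I_n, (j < i)%N ==> (pi j < pi i)%N]].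

Definition Lrmin (n : nat) (pi : {perm 'I_n}) : {set 'I_n} :=
  [set pi i | i : 'I_n & [forall j : 'I_n, (j < i)%N ==> (pi i < pi j)%N]].

Definition Rlmax (n : nat) (pi : {perm 'I_n}) : {set 'I_n} :=
  [set pi i | i : 'I_n & [forall j : 'I_n, (i < j)%N ==> (pi j < pi i)%N]].

(* Initial ascending run: letters pi_1..pi_m with m maximal such that
   pi_1 < ... < pi_m; position i is in it iff pi is increasing on [0, i]. *)
Definition Iar (n : nat) (pi : {perm 'I_n}) : {set 'I_n} :=
  [set pi i | i : 'I_n & [forall j : 'I_n, forall k : 'I_n,
      ((j < k)%N && (k <= i)%N) ==> (pi j < pi k)%N]].

Definition stats (n : nat) (pi : {perm 'I_n}) :=
  (Ides pi, Lrmax pi, Lrmin pi, Rlmax pi, Iar pi).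

Definition patsA : seq (seq nat) :=
  [:: [:: 3;1;2;4;5]; [:: 3;2;1;4;5]; [:: 3;1;2;5;4]; [:: 3;2;1;5;4]].
Definition patsB : seq (seq nat) :=
  [:: [:: 3;1;4;2;5]; [:: 3;2;4;1;5]; [:: 3;1;5;2;4]; [:: 3;2;5;1;4]].

(* Main.v *)
(** A permutation avoids [patsA] iff after no letter [c] one finds a subword
small small big big (relative to [c]), and avoids [patsB] iff after no [c] one
finds small big small big. Swapping two adjacent letters [x < c < y] preceded by
[c] and then by a letter smaller than [c], and followed by a letter larger than
[c], changes none of the five statistics. The swaps are only allowed through
"active" letters [c]: reading a letter [x] activates every earlier [c > x] such
that no active letter lies strictly between [x] and [c]. Two letters separated by
an active letter then activate disjoint sets whatever their order, so an allowed
swap does not affect the others, and three allowed swaps on consecutive letters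
satisfy the braid relation. Hence the rewriting systems that create, respectively
remove, inversions by allowed swaps are both confluent and terminating. Their
normal forms are exactly the avoiders of [patsA] and of [patsB], so that each
class of permutations connected by swaps contains one avoider of either kind, and
the bijection matches these two. *)

Require Import Defs.
From mathcomp Require Import all_boot all_fingroup.
From mathcomp Require Import zify.
Set Implicit Arguments. Unset Strict Implicit. Unset Printing Implicit Defensive.

(** * Abstract rewriting: termination and unique normal forms *)

Inductive star (T : Type) (R : T -> T -> Prop) (x : T) : T -> Prop :=
| star_refl : star R x x
| star_step y z : R x y -> star R y z -> star R x z.

Lemma star_trans (T : Type) (R : T -> T -> Prop) x y z :
  star R x y -> star R y z -> star R x z.
Proof. by elim=> // a b c Rab _ IH /IH; apply: star_step Rab. Qed.

Section Newman.

Variables (T : Type) (R : T -> T -> Prop) (mu : T -> nat).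
Local Notation Rstar := (star R).
Definition normal (x : T) := forall y, ~ R x y.

Hypothesis mu_decr : forall x y, R x y -> mu y < mu x.
Hypothesis reduce : forall x, {y | R x y} + {normal x}.

Lemma normalize (x : T) : {y | Rstar x y & normal y}.
Proof.
have [k] := ubnP (mu x); elim: k x => // k IHk x mux.
have [[y Rxy]|nx] := reduce x; last by exists x => //; constructor.
have [|z Ryz nz] := IHk y; first by apply: leq_trans (mu_decr Rxy) _.
by exists z => //; apply: star_step Rxy Ryz.
Qed.

Hypothesis local_confluence : forall x y z, R x y -> R x z ->
  exists2 t, Rstar y t & Rstar z t.

(** Newman's lemma, by induction on [mu]: the two first steps are joined at some [t], and the
    induction hypothesis identifies both normal forms with a normal form of [t]. *)
Lemma normal_unique x y z :
  Rstar x y -> Rstar x z -> normal y -> normal z -> y = z.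
Proof.
have [k] := ubnP (mu x); elim: k x y z => // k IHk x y z mux.
case=> [|y1 y' Rxy1 Ry1] Rxz; first by case: Rxz => // z1 z' Rxz1 _ /(_ _ Rxz1).
case: Rxz => [_ /(_ _ Rxy1) //|z1 z' Rxz1 Rz1] ny nz.
have [t Rty Rtz] := local_confluence Rxy1 Rxz1.
have [t' Rt nt] := normalize t.
have lt_k u : R x u -> mu u < k by move=> /mu_decr; move: mux; lia.
rewrite (IHk y1 y' t') ?lt_k //; last exact: star_trans Rt.
by rewrite (IHk z1 z' t') ?lt_k //; apply: star_trans Rt.
Qed.

End Newman.

(** * Active letters and separated pairs *)

Definition wakes (A : pred nat) (r : seq nat) (x c : nat) : bool :=
  [&& c \in r, x < c & ~~ has (fun a => A a && (x < a < c)) r].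

(* Prefixes are stored reversed, so that [x :: r] is the prefix [r] followed by
   the letter [x]. *)
Fixpoint act (r : seq nat) (c : nat) : bool :=
  if r is x :: r' then act r' c || wakes (act r') r' x c else false.

Definition between (x y c : nat) := (x < c < y) || (y < c < x).

(** The condition for an allowed swap: [r] is the reversed prefix before the two letters and [v] the
    suffix after them. The smaller letter required after [c] is implied by activity, see
    [act_occ]. *)
Definition sep (r v : seq nat) (x y : nat) : bool :=
  has (fun c => [&& act r c, between x y c & has (ltn c) v]) r.

Lemma act_mem r c : act r c -> c \in r.
Proof.
elim: r => //= x r IHr; rewrite inE => /orP[/IHr ->|/andP[->]]; by rewrite orbT.
Qed.

Lemma wakesP r x c :
  reflect [/\ c \in r, x < c & forall a, act r a -> x < a -> a < c -> False]
          (wakes (act r) r x c).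
Proof.
apply: (iffP and3P) => [[cr xc /hasPn na]|[cr xc na]]; split=> //.
  by move=> a aa xa ac; move: (na a (act_mem aa)); rewrite aa xa ac.
by apply/hasPn => a _; apply/negP => /and3P[aa xa ac]; apply: na aa xa ac.
Qed.

Lemma sepP r v x y :
  reflect (exists c b, [/\ act r c, between x y c, b \in v & c < b])
          (sep r v x y).
Proof.
apply: (iffP hasP) => [[c _ /and3P[ac bc /hasP[b bv cb]]]|[c [b [ac bc bv cb]]]].
  by exists c, b.
exists c; first exact: act_mem.
by rewrite ac bc; apply/hasP; exists b.
Qed.

Lemma sep_sub r r' v v' x y :
  subpred (act r) (act r') -> {subset v <= v'} -> sep r v x y -> sep r' v' x y.
Proof.
move=> rr' vv' /sepP[c [b [ac bc bv cb]]]; apply/sepP; exists c, b.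
by split; [apply: rr'| |apply: vv'|].
Qed.

Lemma sepC r v x y : sep r v x y = sep r v y x.
Proof. by apply: eq_has => c; rewrite /between orbC. Qed.

Lemma act_cons x r : subpred (act r) (act (x :: r)).
Proof. by move=> c /= ->. Qed.

(** If [x < a < y], everything [y] activates, and [y] itself, lies above [a], which already blocks
    it from [x]. If [y < a < x], the letter [a] stops [y] from activating anything above [a], hence
    anything that could block [x]. *)
Lemma wakes_separated r x y a c : act r a -> between x y a ->
  wakes (act (y :: r)) (y :: r) x c = wakes (act r) r x c.
Proof.
move=> aa xy; apply/wakesP/wakesP => -[cr xc na]; split=> //.
- move: cr; rewrite inE => /predU1P[cy|//]; subst c.
  case/orP: xy => /andP[h1 h2]; last by lia.
  by case: (na _ (act_cons _ aa) h1 h2).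
- by move=> d ad; apply: na; apply: act_cons.
- by rewrite inE cr orbT.
move=> d /orP[/na //|/wakesP[dr yd nd]] xd dc.
case/orP: xy => /andP[h1 h2]; first by apply: (na a) => //; lia.
by apply: (nd a) => //; lia.
Qed.

Lemma act_swap r x y a : act r a -> between x y a ->
  act (x :: y :: r) =1 act (y :: x :: r).
Proof.
move=> aa xy c; have yx : between y x a by rewrite /between orbC.
change (act (y :: r) c || wakes (act (y :: r)) (y :: r) x c =
        act (x :: r) c || wakes (act (x :: r)) (x :: r) y c).
by rewrite (wakes_separated _ aa xy) (wakes_separated _ aa yx) /= orbAC.
Qed.

Lemma act_ext x r1 r2 : r1 =i r2 -> act r1 =1 act r2 ->
  act (x :: r1) =1 act (x :: r2).
Proof.
move=> r12 a12 c; rewrite /= a12; congr [|| _ | _].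
rewrite /wakes r12 (eq_has_r r12); congr [&& _, _ & ~~ _].
by apply: eq_has => d; rewrite a12.
Qed.

(** The witness [s] is the letter whose reading activated [c]; the pair starts a pattern of either
    kind. *)
Lemma act_occ r c : act r c -> exists2 s, s < c & subseq [:: c; s] (rev r).
Proof.
elim: r => //= x r IHr /orP[/IHr[s sc sub]|/wakesP[cr xc _]].
  by exists s => //; rewrite rev_cons; apply: subseq_trans sub (subseq_rcons _ _).
exists x => //; rewrite rev_cons -cats1; apply: (@cat_subseq _ [:: c] [:: x]) => //.
by rewrite sub1seq mem_rev.
Qed.

(** Only a smaller letter can activate [a], so reading [t] does not. *)
Lemma act_catrev t r a : act (catrev t r) a -> all (leq a) t -> act r a.
Proof.
elim: t r => //= x t IHt r /IHt IH /andP[ax /IH]; rewrite /= => /orP[//|].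
by case/wakesP; lia.
Qed.

(** Replacing [s] by the first letter below [c] moves it only to the left, so [t] still fits behind
    it. *)
Lemma subseq_first_smaller c s t w : subseq [:: c, s & t] w -> s < c ->
  exists w1 w3 s0 w4, [/\ w = w1 ++ c :: w3 ++ s0 :: w4, all (leq c) w3, s0 < c
    & subseq t w4].
Proof.
move=> + sc; elim: w => // x w IHw /=; case: eqP => [<- {x IHw} sub|_ /IHw]; last first.
  by case=> w1 [w3 [s0 [w4 [-> h1 h2 h3]]]]; exists (x :: w1), w3, s0, w4.
suff [w3 [s0 [w4 [-> h1 h2 h3]]]] : exists w3 s0 w4,
  [/\ w = w3 ++ s0 :: w4, all (leq c) w3, s0 < c & subseq t w4].
  by exists [::], w3, s0, w4.
elim: w sub => // x w IHw /= sub; have [cx|xc] := leqP c x.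
  case: eqP sub => [sx|_ /IHw]; first by lia.
  by case=> w3 [s0 [w4 [-> h1 h2 h3]]]; exists (x :: w3), s0, w4; rewrite /= cx.
exists [::], x, w; split=> //; case: eqP sub => // _.
by apply: subseq_trans; apply: subseq_cons.
Qed.

Lemma act_first_smaller c s r : c \in r -> s < c ->
  act (s :: r) c \/ exists a, [/\ act r a, s < a & a < c].
Proof.
move=> cr sc; rewrite /= /wakes cr sc /=.
have [/hasP[a _ /and3P[aa sa ac]]|_] := boolP (has _ r); last by rewrite orbT; left.
by right; exists a.
Qed.

Lemma mem_catrev (t r : seq nat) x : (x \in catrev t r) = (x \in t) || (x \in r).
Proof. by rewrite catrevE mem_cat mem_rev. Qed.

(** * The swap system, its confluence, and the existence of steps *)

Section Step.

Variable e : rel nat.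

(** [e] orders the two letters before the swap: [ltn] gives the system creating inversions, [gtn]
    the one removing them. The first argument is the reversed prefix already read. *)
Inductive step : seq nat -> seq nat -> seq nat -> Prop :=
| step_here r x y v :
    e x y -> sep r v x y -> step r (x :: y :: v) (y :: x :: v)
| step_cons r x w w' : step (x :: r) w w' -> step r (x :: w) (x :: w').

Lemma step_perm r w w' : step r w w' -> perm_eq w w'.
Proof.
elim=> {r w w'} [r x y v _ _|r x w w' _]; last by rewrite perm_cons.
exact/permPl/(perm_catCA [:: x] [:: y]).
Qed.

(** Used to replay a step after a swap inside the prefix. *)
Lemma step_ext r1 r2 w w' : r1 =i r2 -> act r1 =1 act r2 ->
  step r1 w w' -> step r2 w w'.
Proof.
move=> r12 a12 s; elim: s r2 r12 a12 => {r1 w w'}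
  [r x y v exy sxy|r x w w' s IHs] r2 r12 a12.
  by apply: step_here => //; apply: sep_sub sxy => // a; rewrite a12.
apply: step_cons; apply: IHs; last exact: act_ext.
by move=> z; rewrite !inE r12.
Qed.

Lemma step_inv r x w w' : step r (x :: w) w' ->
  (exists y v, [/\ w = y :: v, w' = y :: x :: v, e x y & sep r v x y]) \/
  (exists2 w1, w' = x :: w1 & step (x :: r) w w1).
Proof.
move=> s; inversion s; subst; first by left; do 2!eexists; split.
by right; eexists.
Qed.

Lemma step_reduce r w : {w' | step r w w'} + {normal (step r) w}.
Proof.
elim: w r => [|x w IHw] r; first by right=> w' s; inversion s.
have [[w' s]|nw] := IHw (x :: r); first by left; exists (x :: w'); constructor.
case: w IHw nw => [|y v] _ nw.
  by right=> w' /step_inv[[y [v [//]]]|[w1 _ /nw]].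
have [/andP[exy sxy]|/negP ns] := boolP (e x y && sep r v x y).
  by left; exists (y :: x :: v); constructor.
right=> w' /step_inv[[y' [v' [[<- <-] _ exy sxy]]]|[w1 _ /nw //]].
by apply: ns; rewrite exy.
Qed.

Lemma step_split r w w' : step r w w' -> exists u x y v,
  [/\ w = u ++ x :: y :: v, w' = u ++ y :: x :: v, e x y
    & sep (catrev u r) v x y].
Proof.
elim=> {r w w'} [r x y v exy sxy|r z w w' _ [u [x [y [v [-> -> exy sxy]]]]]].
  by exists [::], x, y, v.
by exists (z :: u), x, y, v.
Qed.

Lemma step_catrev u r w w' : step (catrev u r) w w' -> step r (u ++ w) (u ++ w').
Proof. by elim: u r => //= x u IHu r s; apply: step_cons; apply: IHu. Qed.

Lemma star_cons r x w w' :
  star (step (x :: r)) w w' -> star (step r) (x :: w) (x :: w').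
Proof.
elim=> [w0|w0 w1 w2 s _]; first exact: star_refl.
by apply: star_step; apply: step_cons.
Qed.

Hypothesis e_trans : transitive e.
Hypothesis e_mono : forall x y z, e x y -> e y z -> (x < y < z) || (z < y < x).
Hypothesis e_total : forall x y, x != y -> e x y || e y x.

(** Makes every swap of the braid relation allowed. Reading [x] cannot activate [c2]: either [c1]
    blocks it or [c2] is below [x]. For the later large letter, [b2] serves all pairs when the
    triple increases; when it decreases, [b1] exceeds [z] and so lies in [v]. *)
Lemma sep_triple r v x y z : (x < y < z) || (z < y < x) ->
  sep r (z :: v) x y -> sep (x :: r) v y z ->
  [/\ sep r v x y, sep r v y z & sep r v x z].
Proof.
move=> xyz /sepP[c1 [b1 [ac1 xc1y b1v c1b1]]] /sepP[c2 [b2 [ac2 yc2z b2v c2b2]]].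
rewrite /between in xc1y yc2z.
have {}ac2 : act r c2.
  case/orP: ac2 => // /wakesP[_ xc2 /(_ c1 ac1)]; lia.
case/orP: xyz => xyz.
  have c1b2 : c1 < b2 by lia.
  split; apply/sepP; [exists c1, b2|exists c2, b2|exists c1, b2];
    by split=> //; rewrite /between; lia.
have {}b1v : b1 \in v by move: b1v; rewrite inE => /predU1P[b1z|//]; lia.
split; apply/sepP; [exists c1, b1|exists c2, b2|exists c1, b1];
  by split=> //; rewrite /between; lia.
Qed.

Lemma step_here_confluence r x y v w : e x y -> sep r v x y ->
  step r (x :: y :: v) w ->
  exists2 t, star (step r) (y :: x :: v) t & star (step r) w t.
Proof.
move=> exy sxy /step_inv[[_ [_ [[<- <-] -> _ _]]]|].
  by exists (y :: x :: v); apply: star_refl.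
case=> w3 -> /step_inv[[z [v' [def_v -> eyz syz]]]|[w4 -> s]].
  subst v.
  have [sxy' syz' sxz] := sep_triple (e_mono exy eyz) sxy syz.
  have exz := e_trans exy eyz.
  have sub_cons t : {subset v' <= t :: v'} by move=> ?; rewrite inE orbC => ->.
  (* Overlapping swaps: both sides of the braid relation end in the reversed triple. *)
  exists [:: z, y, x & v'].
    apply: (star_step (y := [:: y, z, x & v'])).
      by apply/step_cons/step_here => //; apply: sep_sub sxz => //; apply: act_cons.
    apply: star_step (star_refl _ _); apply: step_here => //.
    by apply: sep_sub syz' => // c; apply: act_cons.
  apply: (star_step (y := [:: z, x, y & v'])).
    by apply: step_here => //; apply: sep_sub sxz.
  apply: star_step (star_refl _ _); apply/step_cons/step_here => //.
  by apply: sep_sub sxy' => //; apply: act_cons.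
(* Disjoint swaps commute: [act_swap] keeps the active letters seen by the later one, which itself
   only permutes the suffix seen by the first. *)
exists [:: y, x & w4]; apply: star_step (star_refl _ _).
  apply/step_cons/step_cons; have [c [b [ac xcy _ _]]] := sepP _ _ _ _ sxy.
  apply: step_ext s; last by apply: act_swap ac _; rewrite /between orbC.
  by move=> ?; rewrite !inE orbCA.
apply: step_here => //; apply: sep_sub sxy => // b.
by rewrite (perm_mem (step_perm s)).
Qed.

Lemma step_confluence r w w1 w2 : step r w w1 -> step r w w2 ->
  exists2 t, star (step r) w1 t & star (step r) w2 t.
Proof.
move=> s; elim: s w2 => {r w w1} [r x y v exy sxy|r x w w1 s1 IHs] w2 s2.
  exact: step_here_confluence s2.
case/step_inv: s2 (s2) => [[y [v [def_w -> exy sxy]]] _|[w3 -> s3 _]].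
  have [t t1 t2] : exists2 t, star (step r) (y :: x :: v) t & star (step r) (x :: w1) t.
    by apply: step_here_confluence exy sxy _; rewrite -def_w; apply: step_cons.
  by exists t.
by have [t t1 t2] := IHs _ s3; exists (x :: t); apply: star_cons.
Qed.

(** A discrete intermediate value argument: on the way from [x] to [y] some two adjacent letters lie
    on opposite sides of [c], and [b] still follows them. *)
Lemma step_crossing r w c x y b : act r c -> c \notin w -> e x c -> e c y ->
  c < b -> subseq [:: x; y; b] w -> exists w', step r w w'.
Proof.
move=> ac + exc ecy cb; elim: w r x ac exc => // z w IHw r x ac exc.
rewrite inE negb_or => /andP[cz cw] /=; case: eqP => [<- {z cz}|_ sub]; last first.
  by have [w' s] := IHw (z :: r) x (act_cons z ac) exc cw sub; exists (z :: w'); constructor.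
case: w IHw cw => // z w IHw; rewrite inE negb_or => /andP[cz cw] sub.
have [ecz|/negP necz] := boolP (e c z).
  exists [:: z, x & w]; apply: step_here; first exact: e_trans ecz.
  apply/sepP; exists c, b; split=> //; first exact: e_mono.
  move: sub => /=; case: eqP => _; first by rewrite sub1seq.
  by move/mem_subseq; apply; rewrite !inE eqxx orbT.
have ezc : e z c by have := e_total cz; case/orP.
have [||w' s] := IHw (x :: r) z (act_cons _ ac) ezc.
- by rewrite inE negb_or cz.
- move: sub => /=; case: eqP => [yz|_]; first by case: necz; rewrite -yz.
  by rewrite eqxx.
by exists (x :: w'); constructor.
Qed.

Lemma step_crossing_suffix u v c x y b : uniq (u ++ v) ->
  act (catrev u [::]) c -> e x c -> e c y -> c < b -> subseq [:: x; y; b] v ->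
  exists w', step [::] (u ++ v) w'.
Proof.
rewrite cat_uniq => /and3P[_ /hasPn disj _] ac exc ecy cb sub.
have [|v' s] := step_crossing ac _ exc ecy cb sub; last first.
  by exists (u ++ v'); apply: step_catrev.
by apply: contraL (act_mem ac) => /disj; rewrite mem_catrev orbF.
Qed.

(** Take for [s] the first letter below [c] after it. If [s] activates [c], or if the active letter
    blocking this separates [x] from [y], a crossing gives a step. What remains is a blocking [a]
    that does not separate them. *)
Lemma step_or_blocked w c s1 x y b : uniq w -> subseq [:: c; s1; x; y; b] w ->
  s1 < c -> e x c -> e c y -> c < b ->
  (exists w', step [::] w w') \/ exists w1 w3 s w4 a,
    [/\ w = (w1 ++ c :: w3) ++ s :: w4, all (leq c) w3,
        act (catrev (w1 ++ c :: w3) [::]) a, s < a < c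
      & ~~ (e x a && e a y) /\ subseq [:: x; y; b] w4].
Proof.
move=> uw sub s1c exc ecy cb.
have [w1 [w3 [s [w4 [def_w cw3 sc sub4]]]]] := subseq_first_smaller sub s1c.
set u := w1 ++ c :: w3; set r := catrev u [::].
have def1 : w = u ++ s :: w4 by rewrite def_w -catA.
have def2 : w = (u ++ [:: s]) ++ w4 by rewrite def1 -catA.
have cross a : act (s :: r) a -> e x a -> e a y -> a < b ->
    exists w', step [::] w w'.
  move=> aa xa ay ab; rewrite def2; apply: step_crossing_suffix xa ay ab sub4.
    by rewrite -def2.
  by rewrite catrev_catl.
have cr : c \in r by rewrite mem_catrev mem_cat inE eqxx orbT.
have [ac|[a [aa sa ac]]] := act_first_smaller cr sc; first by left; apply: (cross c).
have [/andP[exa eay]|ne] := boolP (e x a && e a y).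
  by left; apply: (cross a) => //; [apply: act_cons|lia].
by right; exists w1, w3, s, w4, a; rewrite sa ac.
Qed.

End Step.

(** * Both orders, and normal forms versus pattern occurrences *)

Lemma ltn_mono x y z : x < y -> y < z -> (x < y < z) || (z < y < x).
Proof. by move=> -> ->. Qed.

Lemma gtn_mono x y z : gtn x y -> gtn y z -> (x < y < z) || (z < y < x).
Proof. by move=> /= -> ->; rewrite orbT. Qed.

Lemma gtn_trans : transitive gtn.
Proof. by move=> y x z /= yx zy; apply: ltn_trans yx. Qed.

Lemma ltn_totaln x y : x != y -> (x < y) || (y < x).
Proof. by rewrite neq_ltn. Qed.

Lemma gtn_totaln x y : x != y -> gtn x y || gtn y x.
Proof. by rewrite neq_ltn orbC. Qed.

Definition occA w := exists c s1 s2 b1 b2,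
  [/\ subseq [:: c; s1; s2; b1; b2] w, s1 < c, s2 < c, c < b1 & c < b2].
Definition occB w := exists c s1 b1 s2 b2,
  [/\ subseq [:: c; s1; b1; s2; b2] w, s1 < c, s2 < c, c < b1 & c < b2].

Lemma step_occA w w' : step ltn [::] w w' -> occA w.
Proof.
case/step_split=> u [x [y [v [-> _ xy /sepP[c [b [ac xcy bv cb]]]]]]].
have [s sc sub] := act_occ ac; rewrite catrevE cats0 revK in sub.
exists c, s, x, y, b; rewrite /between in xcy; split=> //; try lia.
by apply: (@cat_subseq _ [:: c; s] [:: x; y; b]) => //=; rewrite !eqxx sub1seq.
Qed.

Lemma step_occB w w' : step gtn [::] w w' -> occB w.
Proof.
case/step_split=> u [y [x [v [-> _ /= xy /sepP[c [b [ac xcy bv cb]]]]]]].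
have [s sc sub] := act_occ ac; rewrite catrevE cats0 revK in sub.
exists c, s, y, x, b; rewrite /between in xcy; split=> //; try lia.
by apply: (@cat_subseq _ [:: c; s] [:: y; x; b]) => //=; rewrite !eqxx sub1seq.
Qed.

(** In the blocked case [a] lies below [x], so the ascent from [s] to [x] crosses [a], with [b]
    still above it. *)
Lemma occA_step w : uniq w -> occA w -> exists w', step ltn [::] w w'.
Proof.
move=> uw [c [s1 [x [y [b [sub s1c xc cy cb]]]]]].
have [//|[w1 [w3 [s [w4 [a [def_w _ aa /andP[sa ac] [nxa sub4]]]]]]]] :=
  step_or_blocked ltn_trans ltn_mono ltn_totaln uw sub s1c xc cy cb.
have ax : a < x.
  rewrite ltn_neqAle; apply/andP; split; last by lia.
  move: uw; rewrite def_w cat_uniq => /and3P[_ /hasPn disj _].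
  have /disj : x \in s :: w4.
    by rewrite inE (mem_subseq sub4) ?orbT ?mem_head.
  by apply: contraNneq => <-; have := act_mem aa; rewrite mem_catrev orbF.
rewrite def_w in uw *.
apply: (step_crossing_suffix ltn_trans ltn_mono ltn_totaln uw aa sa ax (_ : a < b)).
  by lia.
rewrite /= eqxx; apply: subseq_trans sub4.
by rewrite /= eqxx; case: ifP; rewrite ?sub1seq ?mem_head ?inE ?eqxx ?orbT.
Qed.

(* The letters between [c] and [s] exceed [c], so [a] is already active when [c]
   is read, and the descent from [c] to [s] crosses it. *)
Lemma occB_step w : uniq w -> occB w -> exists w', step gtn [::] w w'.
Proof.
move=> uw [c [s1 [y [x [b [sub s1c xc cy cb]]]]]].
have [//|[w1 [w3 [s [w4 [a [def_w cw3 aa /andP[sa ac] [nxa sub4]]]]]]]] :=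
  step_or_blocked gtn_trans gtn_mono gtn_totaln uw sub s1c cy xc cb.
have {}aa : act (catrev w1 [::]) a.
  apply: (act_catrev (t := c :: w3)); first by rewrite -catrev_catl.
  by rewrite /= ltnW //; apply: sub_all cw3 => z; apply: leq_trans (ltnW ac).
rewrite def_w -catA in uw *.
apply: (step_crossing_suffix gtn_trans gtn_mono gtn_totaln uw aa ac sa (_ : a < b)).
  by lia.
rewrite cat_cons /= eqxx; apply: (@cat_subseq _ [::] [:: s; b]); rewrite ?sub0seq //=.
by rewrite eqxx sub1seq (mem_subseq sub4) // !inE eqxx !orbT.
Qed.

(** * Termination measures *)

Fixpoint left_weight (w : seq nat) : nat :=
  if w is x :: w' then x * size w' + left_weight w' else 0.

(** Equals the sum of each letter times the number of letters before it, whereas [left_weight]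
    counts the letters after it. An adjacent swap changes either by the difference of its two
    letters, in opposite directions. *)
Fixpoint right_weight (w : seq nat) : nat :=
  if w is x :: w' then sumn w' + right_weight w' else 0.

Lemma step_gtn_weight r w w' :
  step gtn r w w' -> left_weight w' < left_weight w.
Proof.
elim=> {r w w'} [r x y v /= yx _|r x w w' /step_perm/perm_size /= ->]; first by nia.
by rewrite ltn_add2l.
Qed.

Lemma step_ltn_weight r w w' :
  step ltn r w w' -> right_weight w' < right_weight w.
Proof.
elim=> {r w w'} [r x y v /= yx _|r x w w' /step_perm/perm_sumn /= ->]; first by lia.
by rewrite ltn_add2l.
Qed.

(** * Letter positions, permutations as words, pattern containment *)

Lemma index_swap (u v : seq nat) x y a b :
  (a, b) != (x, y) -> (a, b) != (y, x) ->
  (index a (u ++ x :: y :: v) < index b (u ++ x :: y :: v)) =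
  (index a (u ++ y :: x :: v) < index b (u ++ y :: x :: v)).
Proof.
have [->|ab] := eqVneq a b; first by rewrite !ltnn.
rewrite !xpair_eqE !index_cat -!index_mem.
case: (ltnP (index a u)) => ia; case: (ltnP (index b u)) => ib //=.
- by rewrite !ltn_addr.
- by rewrite ![_ < index b u]ltnNge !(leq_trans (ltnW ib) (leq_addr _ _)).
rewrite ?(eq_sym x) ?(eq_sym y).
by case: (a =P x) => ax; case: (a =P y) => ay;
   case: (b =P x) => bx; case: (b =P y) => yb //= h1 h2; lia.
Qed.

Lemma subseq2_index (w : seq nat) a b : uniq w -> subseq [:: a; b] w ->
  index a w < index b w.
Proof.
elim: w => // x w IHw /= /andP[xw uw]; rewrite ![x == _]eq_sym.
case: eqP => [_|_ sub].
  by rewrite sub1seq => bw; case: eqP => // bx; rewrite -bx bw in xw.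
case: eqP => [bx|_]; last exact: IHw.
by case/negP: xw; rewrite -bx (mem_subseq sub) // !inE eqxx orbT.
Qed.

Section Words.

Variable n : nat.
Implicit Types (pi : {perm 'I_n}) (i j x y : 'I_n).

Definition word pi : seq nat := [seq val (pi i) | i <- enum 'I_n].

Lemma size_word pi : size (word pi) = n.
Proof. by rewrite size_map size_enum_ord. Qed.

Lemma word_uniq pi : uniq (word pi).
Proof. by rewrite map_inj_uniq ?enum_uniq // => i j /val_inj/perm_inj. Qed.

Lemma word_perm pi : perm_eq (word pi) (iota 0 n).
Proof.
apply: uniq_perm; rewrite ?word_uniq ?iota_uniq // => k; rewrite mem_iota add0n /=.
apply/mapP/idP => [[i _ ->]|kn]; first exact: ltn_ord.
by exists ((pi^-1)%g (Ordinal kn)); rewrite ?mem_enum ?permKV.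
Qed.

Lemma nth_word pi i : nth 0 (word pi) i = pi i.
Proof. by rewrite (nth_map i) ?size_enum_ord // nth_ord_enum. Qed.

Lemma word_inj : injective word.
Proof. by move=> s t st; apply/permP => i; apply: val_inj; rewrite /= -!nth_word st. Qed.

Lemma word_surj w : perm_eq w (iota 0 n) -> exists pi, word pi = w.
Proof.
move=> wP; have sw : size w = n by rewrite (perm_size wP) size_iota.
have lt_n i : nth 0 w i < n.
  by have := perm_mem wP (nth 0 w i); rewrite mem_nth ?sw // mem_iota add0n => /esym.
have uw : uniq w by rewrite (perm_uniq wP) iota_uniq.
have f_inj : injective (fun i => Ordinal (lt_n i)).
  by move=> i j /(congr1 val)/eqP /=; rewrite nth_uniq ?sw // => /eqP/val_inj.
exists (perm f_inj); apply: (@eq_from_nth _ 0) => [|k]; rewrite size_word ?sw // => kn.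
by rewrite (nth_word _ (Ordinal kn)) permE.
Qed.

Lemma index_word pi x : index (val x) (word pi) = (pi^-1)%g x.
Proof.
have inj : injective (fun i => val (pi i)) by move=> i j /val_inj/perm_inj.
rewrite -{1}(permKV pi x) -[RHS]index_enum_ord; exact: (index_map inj).
Qed.

(** Translates between increasing index maps and subsequences of positions. *)
Lemma sorted_subseq_enum (t : seq 'I_n) :
  sorted (relpre val ltn) t = subseq t (enum 'I_n).
Proof.
have tr : transitive (relpre (val : 'I_n -> nat) ltn) by move=> ? ? ?; apply: ltn_trans.
have ir : irreflexive (relpre (val : 'I_n -> nat) ltn) by move=> ?; apply: ltnn.
have s_enum : sorted (relpre val ltn) (enum 'I_n).
  by rewrite -sorted_map val_enum_ord iota_ltn_sorted.
apply/idP/idP => [st|sub]; last exact: subseq_sorted sub s_enum.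
rewrite (irr_sorted_eq tr ir st (sorted_filter tr (mem t) s_enum)) ?filter_subseq //.
by move=> i; rewrite mem_filter mem_enum andbT.
Qed.

Lemma contains_word pi P : contains pi P <->
  exists s, [/\ subseq s (word pi), size s = size P &
    forall a b, a < size P -> b < size P ->
      (nth 0 s a < nth 0 s b) = (nth 0 P a < nth 0 P b)].
Proof.
split=> [[f [f_mono f_iso]]|[s [sub sP s_iso]]].
  exists [seq val (pi (f a)) | a <- enum 'I_(size P)]; split.
  - rewrite (map_comp (fun i => val (pi i)) f); apply: map_subseq.
    rewrite -sorted_subseq_enum sorted_map.
    apply: (@sub_sorted _ (relpre val ltn)) => [a b|]; first exact: f_mono.
    by rewrite -sorted_map val_enum_ord iota_ltn_sorted.
  - by rewrite size_map size_enum_ord.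
  have nth_s (o : 'I_(size P)) :
      nth 0 [seq val (pi (f a)) | a <- enum 'I_(size P)] o = pi (f o).
    by rewrite (nth_map o) ?size_enum_ord // nth_ord_enum.
  by move=> a b aP bP; rewrite (nth_s (Ordinal aP)) (nth_s (Ordinal bP)) f_iso.
have {sub} [t sub def_s] : exists2 t, subseq t (enum 'I_n) &
    s = [seq val (pi i) | i <- t].
  case/subseqP: sub => m0 sm0 ->; exists (mask m0 (enum 'I_n)); first exact: mask_subseq.
  by rewrite map_mask.
have st : size t = size P by rewrite -sP def_s size_map.
pose f a := tnth (in_tuple t) (cast_ord (esym st) a).
have nth_f (a : 'I_(size P)) i : nth i t a = f a by rewrite /f (tnth_nth i).
exists f; split=> a b.
  move=> ab; rewrite -(nth_f a (f a)) -(nth_f b (f a)).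
  have tr : transitive (relpre (val : 'I_n -> nat) ltn) by move=> ? ? ?; apply: ltn_trans.
  apply: (sorted_ltn_nth tr (f a)); rewrite ?sorted_subseq_enum ?inE ?st //.
by rewrite -s_iso // def_s !(nth_map (f a)) ?st // !nth_f.
Qed.

Lemma avoidsA_word pi : avoids_all pi patsA <-> ~ occA (word pi).
Proof.
split=> [av [c [s1 [s2 [b1 [b2 [sub s1c s2c cb1 cb2]]]]]]|nocc P PA].
  have /= := subseq_uniq sub (word_uniq pi); rewrite !inE => u.
  (* [P] is the standardization of the occurrence; the two comparisons select one of the four
     patterns. *)
  pose P := [:: 3; if s1 < s2 then 1 else 2; if s1 < s2 then 2 else 1;
                 if b1 < b2 then 4 else 5; if b1 < b2 then 5 else 4].
  apply: (av P); first by rewrite /P; do 2!case: ifP.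
  apply/contains_word; exists [:: c; s1; s2; b1; b2]; split=> //.
  rewrite /P; case: ltnP => h1; case: ltnP => h2;
    by move=> [|[|[|[|[|a]]]]] [|[|[|[|[|b]]]]] //= _ _; lia.
case/contains_word=> s [sub sP s_iso]; apply: nocc.
case: s => [|c [|s1 [|s2 [|b1 [|b2 [|? ?]]]]]] in sub sP s_iso;
  try by move: PA sP; rewrite !inE => /or4P[]/eqP->.
exists c, s1, s2, b1, b2.
have i10 := s_iso 1 0; have i20 := s_iso 2 0; have i03 := s_iso 0 3; have i04 := s_iso 0 4.
rewrite /= in i10 i20 i03 i04.
by move: PA i10 i20 i03 i04; rewrite !inE => /or4P[]/eqP-> /= -> // -> // -> // ->.
Qed.

Lemma avoidsB_word pi : avoids_all pi patsB <-> ~ occB (word pi).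
Proof.
split=> [av [c [s1 [b1 [s2 [b2 [sub s1c s2c cb1 cb2]]]]]]|nocc P PB].
  have /= := subseq_uniq sub (word_uniq pi); rewrite !inE => u.
  pose P := [:: 3; if s1 < s2 then 1 else 2; if b1 < b2 then 4 else 5;
                 if s1 < s2 then 2 else 1; if b1 < b2 then 5 else 4].
  apply: (av P); first by rewrite /P; do 2!case: ifP.
  apply/contains_word; exists [:: c; s1; b1; s2; b2]; split=> //.
  rewrite /P; case: ltnP => h1; case: ltnP => h2;
    by move=> [|[|[|[|[|a]]]]] [|[|[|[|[|b]]]]] //= _ _; lia.
case/contains_word=> s [sub sP s_iso]; apply: nocc.
case: s => [|c [|s1 [|b1 [|s2 [|b2 [|? ?]]]]]] in sub sP s_iso;
  try by move: PB sP; rewrite !inE => /or4P[]/eqP->.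
exists c, s1, b1, s2, b2.
have i10 := s_iso 1 0; have i30 := s_iso 3 0; have i02 := s_iso 0 2; have i04 := s_iso 0 4.
rewrite /= in i10 i30 i02 i04.
by move: PB i10 i30 i02 i04; rewrite !inE => /or4P[]/eqP-> /= -> // -> // -> // ->.
Qed.

(** * Invariance of the five statistics *)

Local Notation pos pi := (pi^-1)%g.

(** This criterion and the next four compare only values of letters and their relative positions,
    which is what a swap controls. *)
Lemma IdesP pi x : reflect
  (exists2 y : 'I_n, y = x.+1 :> nat & pos pi y < pos pi x) (x \in Ides pi).
Proof.
rewrite inE; apply: (iffP existsP) => [[y /andP[/eqP]]|[y yx lt]]; first by exists y.
by exists y; rewrite yx eqxx.
Qed.

Lemma LrmaxP pi x : reflect
  (forall y, pos pi y < pos pi x -> y < x) (x \in Lrmax pi).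
Proof.
apply: (iffP imsetP) => [[i + ->] y|lt].
  by rewrite inE permK => /forallP/(_ (pos pi y)); rewrite permKV => /implyP.
exists (pos pi x); rewrite ?permKV // inE; apply/forallP => j; apply/implyP => ji.
by rewrite permKV lt // permK.
Qed.

Lemma LrminP pi x : reflect
  (forall y, pos pi y < pos pi x -> x < y) (x \in Lrmin pi).
Proof.
apply: (iffP imsetP) => [[i + ->] y|lt].
  by rewrite inE permK => /forallP/(_ (pos pi y)); rewrite permKV => /implyP.
exists (pos pi x); rewrite ?permKV // inE; apply/forallP => j; apply/implyP => ji.
by rewrite permKV lt // permK.
Qed.

Lemma RlmaxP pi x : reflect
  (forall y, pos pi x < pos pi y -> y < x) (x \in Rlmax pi).
Proof.
apply: (iffP imsetP) => [[i + ->] y|lt].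
  by rewrite inE permK => /forallP/(_ (pos pi y)); rewrite permKV => /implyP.
exists (pos pi x); rewrite ?permKV // inE; apply/forallP => j; apply/implyP => ji.
by rewrite permKV lt // permK.
Qed.

Lemma IarP pi x : reflect
  (forall y z, pos pi y < pos pi z -> pos pi z <= pos pi x -> y < z) (x \in Iar pi).
Proof.
apply: (iffP imsetP) => [[i + ->] y z yz zi|lt].
  rewrite inE => /forallP/(_ (pos pi y))/forallP/(_ (pos pi z)).
  by rewrite !permKV; move/implyP; apply; rewrite yz; rewrite permK in zi.
exists (pos pi x); rewrite ?permKV // inE; apply/forallP => j; apply/forallP => k.
by apply/implyP => /andP[jk kx]; rewrite lt // !permK.
Qed.

(** Here [p] and [q] are the swapped letters, named by value and not by position so that the
    relation is symmetric; [c] is the separating letter, [s] the smaller letter after it, [b] the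
    later large one. *)
Definition swap_related pi pi' (p q c s b : 'I_n) :=
  [/\ forall y z, (y, z) != (p, q) -> (y, z) != (q, p) ->
        (pos pi y < pos pi z) = (pos pi' y < pos pi' z),
      p < c < q, s < c < b, pos pi c < pos pi s &
      [/\ pos pi s < pos pi p, pos pi s < pos pi q,
          pos pi p < pos pi b & pos pi q < pos pi b]].

Lemma swap_related_sym pi pi' p q c s b :
  swap_related pi pi' p q c s b -> swap_related pi' pi p q c s b.
Proof.
move=> [eqv pcq scb cs [sp sq pb qb]].
have ne_pos y z : pos pi y < pos pi z -> (y == z) = false.
  by move=> yz; apply: contraTF yz => /eqP->; rewrite ltnn.
have [np nq nb nb'] := And4 (ne_pos _ _ sp) (ne_pos _ _ sq) (ne_pos _ _ pb) (ne_pos _ _ qb).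
have cp : (c == p) = false by apply/eqP => cp; move: pcq; rewrite cp; lia.
have cq : (c == q) = false by apply/eqP => cq; move: pcq; rewrite cq; lia.
split=> //; first by move=> y z *; rewrite eqv.
  by rewrite -eqv ?xpair_eqE ?cp ?cq.
by split; rewrite -eqv // ?xpair_eqE ?np ?nq ?[b == _]eq_sym ?nb ?nb' ?andbF.
Qed.

(** [c] keeps [p] and [q] from being consecutive values and [p] from being a left-to-right maximum;
    [s] excludes [q] from [Lrmin] and [b] excludes [p] from [Rlmax]. Symmetry of the relation turns
    these inclusions into equalities. *)
Lemma swap_related_sub pi pi' p q c s b : swap_related pi pi' p q c s b ->
  [/\ Ides pi \subset Ides pi', Lrmax pi \subset Lrmax pi',
      Lrmin pi \subset Lrmin pi', Rlmax pi \subset Rlmax pi'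
    & Iar pi \subset Iar pi'].
Proof.
move=> rel; have [_ _ _ cs' [sp' sq' pb' qb']] := swap_related_sym rel.
case: rel => eqv pcq scb cs [sp sq pb qb].
have cases y z : [\/ (y, z) = (p, q), (y, z) = (q, p) |
    (pos pi y < pos pi z) = (pos pi' y < pos pi' z)].
  have [/eqP|h1] := boolP ((y, z) == (p, q)); first by constructor 1.
  by have [/eqP|h2] := boolP ((y, z) == (q, p)); [constructor 2|constructor 3; apply: eqv].
split; apply/subsetP => x.
- case/IdesP=> y yx lt; apply/IdesP; exists y => //.
  by case: (cases y x) => [[ey ex]|[ey ex]|<- //]; move: yx; rewrite ey ex; lia.
- move/LrmaxP=> lt; apply/LrmaxP => y yx.
  case: (cases y x) => [[-> ->]|[_ ex]|eyx]; [by lia| |by apply: lt; rewrite eyx].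
  by have := lt c; rewrite ex => /(_ (ltn_trans cs sp)); lia.
- move/LrminP=> lt; apply/LrminP => y yx.
  case: (cases y x) => [[_ ex]|[-> ->]|eyx]; [|by lia|by apply: lt; rewrite eyx].
  by have := lt s; rewrite ex => /(_ sq); lia.
- move/RlmaxP=> lt; apply/RlmaxP => y yx.
  case: (cases x y) => [[ex _]|[-> ->]|eyx]; [|by lia|by apply: lt; rewrite eyx].
  by have := lt b; rewrite ex => /(_ pb); lia.
(* The initial run stops before [s], hence before both swapped letters. *)
move/IarP=> lt; apply/IarP => y z yz zx.
have xs : pos pi x < pos pi s.
  by rewrite ltnNge; apply/negP => /(lt _ _ cs); lia.
have xs' : pos pi' x < pos pi' s.
  case: (cases x s) => [[ex es]|[ex es]|<- //].
    by rewrite ex in xs; lia.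
  by rewrite ex in xs; lia.
have yz_pi : pos pi y < pos pi z.
  by case: (cases y z) => [[_ ez]|[_ ez]|-> //]; move: zx; rewrite ez; lia.
apply: lt => //; rewrite leqNgt; apply/negP => xz.
case: (cases x z) => [[ex _]|[ex _]|]; try by rewrite ex in xs; lia.
by rewrite xz => /esym; lia.
Qed.

Lemma swap_related_stats pi pi' p q c s b :
  swap_related pi pi' p q c s b -> stats pi = stats pi'.
Proof.
move=> rel; have [i1 i2 i3 i4 i5] := swap_related_sub rel.
have [j1 j2 j3 j4 j5] := swap_related_sub (swap_related_sym rel).
by congr (_, _, _, _, _); apply/eqP; rewrite eqEsubset; apply/andP.
Qed.

Lemma step_stats e pi pi' :
  step e [::] (word pi) (word pi') -> stats pi = stats pi'.
Proof.
case/step_split=> u [x [y [v [def_w def_w' exy /sepP[c [b [ac xcy bv cb]]]]]]].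
have [s sc sub] := act_occ ac; rewrite catrevE cats0 revK in sub.
have ord z : z \in word pi -> exists z' : 'I_n, z = z'.
  by case/mapP=> i _ ->; exists (pi i).
have {}sub : subseq [:: c; s; x; y; b] (word pi).
  rewrite def_w; apply: (@cat_subseq _ [:: c; s] [:: x; y; b]) => //=.
  by rewrite !eqxx sub1seq.
(* Each mask below picks two letters of the occurrence and yields their order of position. *)
have lt_pos (m : bitseq) z t : mask m [:: c; s; x; y; b] = [:: z; t] ->
    index z (word pi) < index t (word pi).
  move=> zt; apply: subseq2_index (word_uniq pi) _.
  by rewrite -zt; apply: subseq_trans (mask_subseq _ _) sub.
have cs := lt_pos [:: true; true] _ _ erefl.
have sx := lt_pos [:: false; true; true] _ _ erefl.
have sy := lt_pos [:: false; true; false; true] _ _ erefl.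
have xb := lt_pos [:: false; false; true; false; true] _ _ erefl.
have yb := lt_pos [:: false; false; false; true; true] _ _ erefl.
have mem z : z \in [:: c; s; x; y; b] -> exists z' : 'I_n, z = z'.
  by move/(mem_subseq sub); apply: ord.
have [c' ?] : exists z' : 'I_n, c = z' by apply: mem; rewrite !inE eqxx.
have [s' ?] : exists z' : 'I_n, s = z' by apply: mem; rewrite !inE eqxx ?orbT.
have [x' ?] : exists z' : 'I_n, x = z' by apply: mem; rewrite !inE eqxx ?orbT.
have [y' ?] : exists z' : 'I_n, y = z' by apply: mem; rewrite !inE eqxx ?orbT.
have [b' ?] : exists z' : 'I_n, b = z' by apply: mem; rewrite !inE eqxx ?orbT.
subst; rewrite !index_word in cs sx sy xb yb.
have eqv z t : (z, t) != (x', y') -> (z, t) != (y', x') ->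
    (pos pi z < pos pi t) = (pos pi' z < pos pi' t).
  by move=> h1 h2; rewrite -!index_word def_w def_w' index_swap.
case/orP: xcy => xcy.
  apply: (swap_related_stats (p := x') (q := y') (c := c') (s := s') (b := b')).
  by split=> //; rewrite sc cb.
apply: (swap_related_stats (p := y') (q := x') (c := c') (s := s') (b := b')).
by split=> //; [move=> z t h1 h2; apply: eqv|rewrite sc cb].
Qed.

Lemma step_word e pi w : step e [::] (word pi) w -> exists pi', word pi' = w.
Proof.
move=> st; apply: word_surj; apply: perm_trans (word_perm pi).
by rewrite perm_sym (step_perm st).
Qed.

Lemma star_word e pi w : star (step e [::]) (word pi) w ->
  exists2 pi', word pi' = w & stats pi' = stats pi.
Proof.
move def_w0 : (word pi) => w0 st; elim: st pi def_w0 => {w0 w} [w|w w1 w2 st _ IH] pi def_w; first by exists pi.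
rewrite -def_w in st; have [pi1 def_w1] := step_word st.
have [pi2 def_w2 eq2] := IH pi1 def_w1; exists pi2; rewrite ?eq2 //.
by symmetry; apply: (@step_stats e); rewrite def_w1.
Qed.

End Words.

(** * Reversing steps, and the bijection *)

Lemma step_converse (e e' : rel nat) r w w' : (forall x y, e x y -> e' y x) ->
  step e r w w' -> step e' r w' w.
Proof.
move=> ee'; elim=> {r w w'} [r x y v exy sxy|r x w w' _]; last exact: step_cons.
by apply: step_here; [exact: ee'|rewrite sepC].
Qed.

Lemma star_converse (e e' : rel nat) r w w' : (forall x y, e x y -> e' y x) ->
  star (step e r) w w' -> star (step e' r) w' w.
Proof.
move=> ee'; elim=> {w w'} [w|w w1 w2 st _ IH]; first exact: star_refl.
by apply: star_trans IH (star_step (step_converse ee' st) (star_refl _ _)).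
Qed.

Theorem theorem1p1 : forall n : nat, (1 <= n)%N ->
  exists alpha : {perm 'I_n} -> {perm 'I_n},
    (forall pi, avoids_all pi patsA -> avoids_all (alpha pi) patsB) /\
    (forall pi1 pi2, avoids_all pi1 patsA -> avoids_all pi2 patsA ->
        alpha pi1 = alpha pi2 -> pi1 = pi2) /\
    (forall sigma, avoids_all sigma patsB ->
        exists pi, avoids_all pi patsA /\ alpha pi = sigma) /\
    (forall pi, avoids_all pi patsA -> stats (alpha pi) = stats pi).
Proof.
move=> n _.
have avA pi : avoids_all pi patsA <-> normal (step ltn [::]) (@word n pi).
  rewrite avoidsA_word; split=> [nocc w /step_occA //|nw].
  by move/(occA_step (word_uniq pi)) => [w /nw].
have avB pi : avoids_all pi patsB <-> normal (step gtn [::]) (@word n pi).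
  rewrite avoidsB_word; split=> [nocc w /step_occB //|nw].
  by move/(occB_step (word_uniq pi)) => [w /nw].
have uniqA := normal_unique (@step_ltn_weight [::]) (step_reduce ltn [::])
  (@step_confluence ltn ltn_trans ltn_mono [::]).
have uniqB := normal_unique (@step_gtn_weight [::]) (step_reduce gtn [::])
  (@step_confluence gtn gtn_trans gtn_mono [::]).
pose nfA := normalize (@step_ltn_weight [::]) (step_reduce ltn [::]).
pose nfB := normalize (@step_gtn_weight [::]) (step_reduce gtn [::]).
(* [alpha] takes the normal form for removing inversions. The default [pi] only makes it total: by
   [star_word] the pick succeeds. *)
pose alpha pi := odflt pi [pick sigma | @word n sigma == s2val (nfB (word pi))].
have alphaP pi : [/\ star (step gtn [::]) (word pi) (word (alpha pi)),
    normal (step gtn [::]) (word (alpha pi)) & stats (alpha pi) = stats pi].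
  rewrite /alpha; case: (nfB _) => /= w st nw; have [sigma def_w st_sigma] := star_word st.
  case: pickP => [tau /eqP def_w'|/(_ sigma)]; last by rewrite def_w eqxx.
  have -> : odflt pi (Some tau) = sigma by apply: word_inj; rewrite def_w'.
  by rewrite def_w.
have alpha_rev pi : star (step ltn [::]) (word (alpha pi)) (word pi).
  by have [st _ _] := alphaP pi; apply: star_converse st.
exists alpha; split; first by move=> pi _; apply/avB; case: (alphaP pi).
split.
  (* Reversed, the paths make [pi1] and [pi2] normal forms of their common image. *)
  move=> pi1 pi2 /avA n1 /avA n2 eq12; apply: word_inj; apply: uniqA n1 n2.
    exact: alpha_rev.
  by rewrite eq12.
split; last by move=> pi _; case: (alphaP pi).
(* The preimage is the [ltn] normal form of [sigma]; then [sigma] and [alpha pi] are both [gtn]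
   normal forms of [pi]. *)
move=> sigma /avB nsigma; case: (nfA (word sigma)) => w st nw.
have [pi def_w _] := star_word st; rewrite -def_w in st nw.
exists pi; split; first exact/avA.
have [st' n' _] := alphaP pi; apply: word_inj; apply: uniqB st' _ n' nsigma.
exact: star_converse st.
Qed.
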